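(* The composition $v\cdot w:=vwp_{v,w}$, which associates with two composable partial isometries $v,w$ between Hilbert spaces the partial isometry contained in $vw$, is associative. That is, for all Hilbert spaces $H_1,H_2,H_3,H_4$ and all partial isometries $w\colon H_1\to H_2$, $v\colon H_2\to H_3$, $u\colon H_3\to H_4$, one has $(u\cdot v)\cdot w=u\cdot(v\cdot w)$.
   Context: Hilbert spaces are complex and operators are bounded and linear. A projection is an operator $p$ on a Hilbert space with $p^*p=p$ (that is, an orthogonal projection). An operator $v$ between Hilbert spaces is a partial isometry if $vv^*v=v$. For a contraction $c\colon H\to K$ between Hilbert spaces, $\{x\in H\colon\lVert cx\rVert=\lVert x\rVert\}$ is a closed subspace of $H$; denote by $p_c$ the projection onto it. The operator $cp_c$ is a partial isometry with initial projection $p_c$, called the partial isometry contained in $c$. For partial isometries $w\colon G\to H$ and $v\colon H\to K$ (so that $vw$ is a contraction), $p_{v,w}:=p_{vw}$ is the projection onto $\{x\in G\colon\lVert vwx\rVert=\lVert x\rVert\}$, and $v\cdot w:=vwp_{v,w}$ is a partial isometry $G\to K$. *)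

(* Defs.v *)
From HB Require Import structures.
From mathcomp Require Import all_boot all_order all_algebra.
From mathcomp Require Import sesquilinear complex.
From mathcomp Require Import all_classical all_reals topology normedtype.

Set Implicit Arguments.
Unset Strict Implicit.
Unset Printing Implicit Defensive.

Import Order.TTheory GRing.Theory Num.Theory numFieldNormedType.Exports.

Local Open Scope classical_set_scope.
Local Open Scope complex_scope.
Local Open Scope ring_scope.

(* Complex Hilbert spaces. The norm of a normed module over R[i] takes its
   values in R[i]; hdot is linear in its first argument and conjugate-linear in
   its second. *)
HB.mixin Record CompleteNormedModule_isHilbert (R : realType) H
    of CompleteNormedModule R[i] H := {
  hdot : {dot H for Num.conj} ;
  hdotE : forall x : H, hdot x x = `|x| ^+ 2
}.

#[short(type="hilbertType")]
HB.structure Definition Hilbert (R : realType) :=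
  {H of CompleteNormedModule_isHilbert R H & CompleteNormedModule R[i] H}.

HB.mixin Record isBoundedOp (R : realType) (H K : hilbertType R)
    (f : H -> K) := {
  boundedop_subproof : exists M : R[i], forall x, `|f x| <= M * `|x|
}.

HB.structure Definition BoundedOp (R : realType) (H K : hilbertType R) :=
  {f of @GRing.Linear R[i] H K *:%R f & isBoundedOp R H K f}.

Reserved Notation "''B(' H , K )" (format "''B(' H ,  K )").
Notation "''B(' H , K )" := (BoundedOp.type H K) : type_scope.

Lemma boundedopP (R : realType) (H K : hilbertType R) (f g : 'B(H, K)) :
  f =1 g -> f = g.
Proof.
case: f g => [f [[fN] [fZ] [fB]]] [g [[gN] [gZ] [gB]]] /= /funext fg.
move: fN fZ fB; rewrite {}fg => fN fZ fB.
by rewrite (Prop_irrelevance fN gN) (Prop_irrelevance fZ gZ)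
  (Prop_irrelevance fB gB).
Qed.

Lemma zero_bounded (R : realType) (H K : hilbertType R) :
  exists M : R[i], forall x : H, `|(\0 : H -> K) x| <= M * `|x|.
Proof. by exists 0 => x; rewrite normr0 mul0r. Qed.

HB.instance Definition _ (R : realType) (H K : hilbertType R) :=
  isBoundedOp.Build R H K \0 (@zero_bounded R H K).

Lemma comp_bounded (R : realType) (G H K : hilbertType R)
    (a : 'B(H, K)) (b : 'B(G, H)) :
  exists M : R[i], forall x, `|(a \o b) x| <= M * `|x|.
Proof.
have [M aM] := @boundedop_subproof _ _ _ a.
have [N bN] := @boundedop_subproof _ _ _ b.
have [b0|/existsNP[x0 /eqP bx0]] := pselect (forall x, b x = 0).
  by exists 0 => x /=; rewrite b0 linear0 normr0 mul0r.
have M0 : 0 <= M.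
  by rewrite -(pmulr_lge0 _ (_ : 0 < `|b x0|)) ?normr_gt0// (le_trans _ (aM _)).
exists (M * N) => x /=; rewrite (le_trans (aM _))// -mulrA.
exact: ler_wpM2l.
Qed.

HB.instance Definition _ (R : realType) (G H K : hilbertType R)
    (a : 'B(H, K)) (b : 'B(G, H)) :=
  isBoundedOp.Build R G K (a \o b) (comp_bounded a b).

HB.instance Definition _ (R : realType) (H K : hilbertType R) :=
  gen_eqMixin 'B(H, K).
HB.instance Definition _ (R : realType) (H K : hilbertType R) :=
  gen_choiceMixin 'B(H, K).
HB.instance Definition _ (R : realType) (H K : hilbertType R) :=
  isPointed.Build 'B(H, K) (\0 : H -> K).

Section PartialIsometries.
Variable R : realType.
Implicit Types G H K : hilbertType R.

Definition opcomp G H K (a : 'B(H, K)) (b : 'B(G, H)) : 'B(G, K) := a \o b.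

(* [get P] is a chosen element of P (and 0 if P is empty): the adjoint of a
   bounded operator and the projection onto a closed subspace exist and are
   unique, by the Riesz and projection theorems. For a contraction c, the set
   defining [iso_projection c] is a closed subspace; the values of
   [iso_projection] and [contained_pisom] at other operators are irrelevant. *)
Definition adjoint H K (a : 'B(H, K)) : 'B(K, H) :=
  get [set b : 'B(K, H) | forall x y, hdot (a x) y = hdot x (b y)].

Definition projection H (p : 'B(H, H)) : Prop := opcomp (adjoint p) p = p.

Definition projection_onto H (A : set H) : 'B(H, H) :=
  get [set p : 'B(H, H) | projection p /\ range p = A].

Definition partial_isometry H K (v : 'B(H, K)) : Prop :=
  opcomp v (opcomp (adjoint v) v) = v.

(* p_c *)
Definition iso_projection H K (c : 'B(H, K)) : 'B(H, H) :=
  projection_onto [set x : H | `|c x| = `|x|].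

(* c p_c *)
Definition contained_pisom H K (c : 'B(H, K)) : 'B(H, K) :=
  opcomp c (iso_projection c).

Definition pisom_comp G H K (v : 'B(H, K)) (w : 'B(G, H)) : 'B(G, K) :=
  contained_pisom (opcomp v w).

End PartialIsometries.

Reserved Notation "v \cdot w" (at level 40, left associativity).
Notation "v \cdot w" := (pisom_comp v w) : ring_scope.

(* Main.v *)
From HB Require Import structures.
Require Import Defs.
From mathcomp Require Import all_boot all_order all_algebra.
From mathcomp Require Import sesquilinear complex lra.
From mathcomp Require Import all_classical all_reals topology normedtype.

Set Implicit Arguments.
Unset Strict Implicit.
Unset Printing Implicit Defensive.

Import Order.TTheory GRing.Theory Num.Theory numFieldNormedType.Exports.

Local Open Scope classical_set_scope.
Local Open Scope complex_scope.
Local Open Scope ring_scope.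

(* For contractions, |uvwx| = |x| forces |vwx| = |wx| = |x|, and then p_{u,v}
   fixes wx and p_{v,w} fixes x. Conversely, a projection p satisfies
   |px| <= |x| with equality only if px = x, so the partial isometries
   (u.v)w and u(v.w) attain the norm of x exactly when uvw does. Both triple
   products are therefore uvw restricted by the projection onto
   {x : |uvwx| = |x|}. That this projection exists is the projection theorem for
   closed subspaces; linearity of the set comes from the parallelogram law. *)

(** * Inner product and norm identities *)

Section HilbertSpace.
Variables (R : realType) (H : hilbertType R).
Implicit Types (x y z : H) (a : R[i]).

Lemma hdotC x y : hdot x y = (hdot y x)^*%R.
Proof. by rewrite (hermC hdot x y) expr0 mul1r. Qed.

Lemma hdotBr x y z : hdot x (y - z) = hdot x y - hdot x z.
Proof. exact: linearBr. Qed.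

Lemma hdotBl x y z : hdot (x - y) z = hdot x z - hdot y z.
Proof. exact: linearBl. Qed.

Lemma hdotDl x y z : hdot (x + y) z = hdot x z + hdot y z.
Proof. exact: linearDl. Qed.

Lemma hdotZr a x y : hdot x (a *: y) = a^*%R * hdot x y.
Proof. exact: (linearZr_LR hdot x a y). Qed.

Lemma hdotZl a x y : hdot (a *: x) y = a * hdot x y.
Proof. exact: (linearZl_LR hdot). Qed.

Lemma sqr_normD x y :
  `|x + y| ^+ 2 = `|x| ^+ 2 + `|y| ^+ 2 + (hdot x y + (hdot x y)^*%R).
Proof. by rewrite -!hdotE; exact: (dnormD hdot). Qed.

Lemma sqr_normB x y :
  `|x - y| ^+ 2 = `|x| ^+ 2 + `|y| ^+ 2 - (hdot x y + (hdot x y)^*%R).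
Proof. by rewrite -!hdotE; exact: (dnormB hdot). Qed.

Lemma parallelogram x y :
  `|x + y| ^+ 2 + `|x - y| ^+ 2 = 2 * (`|x| ^+ 2 + `|y| ^+ 2).
Proof.
by rewrite sqr_normD sqr_normB addrACA subrr addr0 -mulr2n mulr_natl.
Qed.

Lemma hdot_eq0 x : hdot x x = 0 -> x = 0.
Proof. by rewrite hdotE => /eqP; rewrite sqrf_eq0 normr_eq0 => /eqP. Qed.

(* R[i] is only partially ordered: infima and lra need the norm in R. *)
Let N x : R := complex.Re `|x|.

Let NE x : `|x| = (N x)%:C.
Proof. by rewrite /N RRe_real// ger0_real. Qed.

Let N_ge0 x : 0 <= N x.
Proof. by rewrite -ler0c -NE. Qed.

Let N_le x y : (`|x| <= `|y|) = (N x <= N y).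
Proof. by rewrite !NE lecR. Qed.

Let ler_ND x y : N (x + y) <= N x + N y.
Proof. by rewrite -lecR rmorphD/= -!NE ler_normD. Qed.

Let NZ (t : R) x : 0 <= t -> N (t%:C *: x) = t * N x.
Proof.
by move=> t0; apply: complexI; rewrite rmorphM/= -!NE normrZ ger0_norm// ler0c.
Qed.

Let Nparallelogram x y :
  N (x + y) ^+ 2 + N (x - y) ^+ 2 = 2 * (N x ^+ 2 + N y ^+ 2).
Proof.
apply: complexI; rewrite [RHS]rmorphM rmorph_nat !rmorphD !rmorphXn/=.
by rewrite -!NE parallelogram.
Qed.

(** * Orthogonal projection onto a closed subspace *)

Variable A : set H.
Hypotheses (A0 : A 0) (AD : forall x y, A x -> A y -> A (x + y))
  (AZ : forall a x, A x -> A (a *: x)) (Acl : closed A).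

(** The near-minimisers [B e] of the distance to [x] generate a Cauchy filter by the parallelogram
    law; completeness gives a limit [l], and closedness puts it in [A]. *)
Lemma nearest_point x :
  exists2 l, A l & forall b, A b -> `|x - l| <= `|x - b|.
Proof.
pose S := [set N (x - b) | b in A]; pose s := inf S.
have Slb : has_lbound S by exists 0 => _ [b Ab <-].
have infS : has_inf S by split => //; exists (N (x - 0)), 0.
have s_le b : A b -> s <= N (x - b) by move=> Ab; apply: ge_inf => //; exists b.
have s0 : 0 <= s by apply: lb_le_inf; [case: infS|move=> _ [b Ab <-]].
pose B (e : R) := [set b | A b /\ N (x - b) < s + e].
(* The midpoint of b and c lies in A, so its distance to x is at least s. *)
have Bdiam e b c : 0 < e <= 1 -> B e b -> B e c ->
    N (b - c) ^+ 2 <= 4 * e * (2 * s + 1).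
  move=> /andP[e0 e1] [Ab bs] [Ac cs].
  have := Nparallelogram (x - c) (x - b).
  have -> : x - c - (x - b) = b - c by rewrite opprB addrC addrA subrK.
  have -> : x - c + (x - b) = (2 : R)%:C *: (x - 2^-1 *: (b + c)).
    rewrite (_ : 2%:C = 2); last exact: (rmorph_nat (real_complex R) 2).
    rewrite scalerBr scalerA divff ?pnatr_eq0// scale1r.
    by rewrite scaler_nat mulr2n opprD addrACA [- b - c]addrC.
  rewrite NZ// => par.
  (* The bound is 4 (s + e)^2 - 4 s^2 = 4 e (2 s + e), where e <= 1. *)
  have := s_le _ (AZ 2^-1 (AD Ab Ac)).
  have := N_ge0 (x - b); have := N_ge0 (x - c); nra.
pose F := filter_from [set e : R | 0 < e] B.
have FF : ProperFilter F.
  apply: filter_from_proper.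
    apply: filter_from_filter; first by exists 1 => /=.
    move=> e f /= e0 f0; exists (Num.min e f); first by rewrite /= lt_min e0.
    move=> b [Ab]; rewrite -ltrBlDl lt_min => /andP[be bf].
    by split; split => //; rewrite -ltrBlDl.
  move=> e /= e0; have [_ [b Ab <-] bs] := inf_adherent e0 infS.
  by exists b.
have Fcauchy : cauchy F.
  apply: cauchy_exP => e e0.
  have [r r0 ->] : exists2 r : R, 0 < r & e = r%:C.
    exists (complex.Re e); first by move: e0; rewrite ltcE => /andP[].
    by rewrite RRe_real// gtr0_real.
  (* The final [+ 1] makes 4 d (2 s + 1), the bound from [Bdiam], strictly smaller than r^2. *)
  pose d := Num.min 1 (r ^+ 2 / (4 * (2 * s + 1) + 1)).
  have d0 : 0 < d by rewrite lt_min ltr01 divr_gt0 ?exprn_gt0//; lra.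
  have [_ [b Ab <-] bs] := inf_adherent d0 infS.
  exists b, d => //= c dc; rewrite -ball_normE/= NE ltcR.
  have d1 : d <= 1 by rewrite ge_min lexx.
  have dr : d * (4 * (2 * s + 1) + 1) <= r ^+ 2.
    by rewrite -ler_pdivlMr ?ge_min ?lexx ?orbT//; lra.
  have := @Bdiam d b c; rewrite d0 d1 => /(_ isT (conj Ab bs) dc).
  have := N_ge0 (b - c); nra.
have /cvg_ex[l Fl] : cvg F by exact: cauchy_cvg.
have near_l e : 0 < e -> exists b, [/\ A b, N (x - b) < s + e & N (b - l) < e].
  move=> e0.
  have Fle : F (ball l e%:C) by apply/Fl/nbhsx_ballx; rewrite ltcR.
  have [|b [[Ab be] bl]] := @filter_ex _ F _ (B e `&` ball l e%:C).
    by apply: filterI => //; exists e.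
  exists b; split => //; move: bl; rewrite -ball_normE/= -ltcR -NE.
  by rewrite distrC.
exists l.
  apply: Acl => U /Fl [e /= e0 BU].
  have [b Bb] := filter_ex (ex_intro2 _ _ e e0 (@subset_refl _ (B e)) : F (B e)).
  by exists b; split; [case: Bb|exact: BU].
move=> b Ab; rewrite N_le; apply: le_trans (s_le _ Ab).
apply/ler_addgt0Pr => e e0.
have [|c [Ac cs cl]] := near_l (e / 2); first by rewrite divr_gt0.
have := ler_ND (x - c) (c - l); rewrite addrA subrK; lra.
Qed.

(** First variation at the nearest point: moving [l] within [A] along [b] cannot shorten [x - l]. *)
Lemma orthogonal_decomposition x :
  exists l, A l /\ forall b, A b -> hdot (x - l) b = 0.
Proof.
have [l Al lmin] := nearest_point x; exists l; split=> // b Ab.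
have [->|b0] := eqVneq b 0; first exact: linear0r.
set y := x - l; set h := hdot y b.
(* [t *: b] is the component of [y] along [b], so |y - t b|^2 = |y|^2 - |h|^2 / |b|^2, and
   minimality forces [h] to vanish. *)
pose t := h / `|b| ^+ 2.
have bb0 : `|b| ^+ 2 != 0 by rewrite sqrf_eq0 normr_eq0.
have : `|y| <= `|y - t *: b|.
  by rewrite /y -addrA -opprD; apply/lmin/AD => //; exact: AZ.
rewrite -ler_sqr ?nnegrE// (sqr_normB y (t *: b)) normrZ exprMn hdotZr -/h.
have bbC : (`|b| ^+ 2)^*%R = `|b| ^+ 2 by rewrite geC0_conj// exprn_ge0.
have -> : t^*%R * h = `|h| ^+ 2 / `|b| ^+ 2.
  by rewrite /t rmorphM/= fmorphV/= bbC mulrAC -normCKC.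
have -> : `|t| ^+ 2 * `|b| ^+ 2 = `|h| ^+ 2 / `|b| ^+ 2.
  rewrite /t normrM normfV (ger0_norm (exprn_ge0 2 (normr_ge0 b))) exprMn.
  by rewrite [_^-1 ^+ 2]expr2 -!mulrA mulVf// mulr1.
have -> : (`|h| ^+ 2 / `|b| ^+ 2)^*%R = `|h| ^+ 2 / `|b| ^+ 2.
  by rewrite geC0_conj// divr_ge0 ?exprn_ge0.
rewrite opprD addrA addrK lerBrDr gerDl pmulr_lle0; last first.
  by rewrite invr_gt0 exprn_gt0// normr_gt0.
by move=> h0; apply/eqP; rewrite -normr_eq0 -sqrf_eq0 eq_le h0 exprn_ge0.
Qed.

Lemma projection_exists :
  exists p : 'B(H, H), [/\ forall x, A (p x), forall x, A x -> p x = x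
    & forall x y, hdot (p x) y = hdot x (p y)].
Proof.
have [f /all_and2[Af fo]] := choice orthogonal_decomposition.
have AB x y : A x -> A y -> A (x - y).
  by move=> Ax Ay; rewrite -scaleN1r; apply/AD/AZ.
(* Uniqueness of the foot makes the chosen [f] linear: [f x - l] lies in [A] and is orthogonal to
   [A], hence to itself. *)
have funiq x l : A l -> (forall b, A b -> hdot (x - l) b = 0) -> f x = l.
  move=> Al lo; apply/eqP; rewrite -subr_eq0; apply/eqP/hdot_eq0.
  have Afl := AB _ _ (Af x) Al.
  rewrite [X in hdot X _](_ : _ = (x - l) - (x - f x)).
    by rewrite hdotBl lo// fo// subrr.
  by rewrite opprB [RHS]addrC addrA subrK.
have flin : linear f.
  move=> a x y; apply: funiq => [|b Ab]; first exact/AD/Af/AZ/Af.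
  rewrite opprD addrACA -scalerBr hdotDl hdotZl.
  by rewrite fo// fo// mulr0 addr0.
have fbound : exists M : R[i], forall x, `|f x| <= M * `|x|.
  exists 1 => x; rewrite mul1r -ler_sqr ?nnegrE//.
  rewrite -[X in _ <= `|X| ^+ 2](subrK (f x)) sqr_normD fo// conjC0 !addr0.
  by rewrite lerDr exprn_ge0.
pose linf := GRing.isLinear.Build R[i] H H *:%R f flin.
pose bdf := isBoundedOp.Build R H H f fbound.
pose p : 'B(H, H) := HB.pack f linf bdf.
exists p; split => [x|x Ax|x y] /=; first exact: Af.
  by apply: funiq => // b _; rewrite subrr; exact: linear0l.
(* Both [x - f x] and [y - f y] are orthogonal to [A], which contains [f x] and [f y]. *)
transitivity (hdot (f x) (f y)).
  apply/eqP; rewrite -subr_eq0 -hdotBr hdotC fo//; exact/eqP/conjC0.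
by apply/esym/eqP; rewrite -subr_eq0 -hdotBl fo.
Qed.
End HilbertSpace.

(** * Adjoints, projections and partial isometries *)

Section Operators.
Variable R : realType.
Implicit Types G H K : hilbertType R.

(* The alternative \0 is the junk value of [get]; covering it makes the Riesz
   theorem unnecessary. *)
Lemma adjointP H K (c : 'B(H, K)) :
  (forall x y, hdot (c x) y = hdot x (adjoint c y)) \/
  adjoint c = \0 :> (K -> H).
Proof.
rewrite /adjoint; set P := [set b | _].
have [[b Pb]|/forallNP noP] := pselect (exists b, P b).
  by left; apply: (getPex (ex_intro P b Pb)).
by right; rewrite getPN.
Qed.

(** Both sides equal [hdot (p x) (p y)], because [adjoint p] fixes the range of [p]; if the adjoint
    is the default [\0], then [p] vanishes. *)
Lemma projection_adjoint H (p : 'B(H, H)) : projection p ->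
  forall x y, hdot (p x) y = hdot x (p y).
Proof.
move=> pp; have pE x : adjoint p (p x) = p x by rewrite -[in RHS]pp.
have [pa|p0] := adjointP p; last first.
  by move=> x y; rewrite -(pE x) -(pE y) p0 linear0l linear0r.
by move=> x y; rewrite -(pE y) -pa hdotC -[in LHS](pE x) -pa -hdotC.
Qed.

Lemma projection_idem H (p : 'B(H, H)) : projection p ->
  forall x, p (p x) = p x.
Proof.
move=> pp x; have pE z : adjoint p (p z) = p z by rewrite -[in RHS]pp.
have pa := projection_adjoint pp.
have [pa'|p0] := adjointP p; last by rewrite -[p x]pE p0 linear0.
apply/eqP; rewrite -subr_eq0; apply/eqP/hdot_eq0.
by rewrite -[X in hdot _ (_ - X)]pE hdotBr -pa -pa' subrr.
Qed.

(** [p] itself inhabits the set from which [adjoint p] is chosen, so the choice is a genuine adjoint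
    and agrees with [p]. *)
Lemma selfadjoint_idem_projection H (p : 'B(H, H)) :
  (forall x y, hdot (p x) y = hdot x (p y)) -> (forall x, p (p x) = p x) ->
  projection p.
Proof.
move=> pa pp; apply: boundedopP => x /=.
have pa' : forall x y, hdot (p x) y = hdot x (adjoint p y).
  exact: (getPex (ex_intro
    [set b : 'B(H, H) | forall x y, hdot (p x) y = hdot x (b y)] p pa)).
apply/eqP; rewrite -subr_eq0; apply/eqP/hdot_eq0.
by rewrite -[X in hdot _ (_ - X)]pp hdotBr -pa' -[X in _ - X]pa subrr.
Qed.

Lemma projection_pythagoras H (p : 'B(H, H)) : projection p ->
  forall x, `|x| ^+ 2 = `|p x| ^+ 2 + `|x - p x| ^+ 2.
Proof.
move=> pp x; have o : hdot (x - p x) (p x) = 0.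
  rewrite -(projection_adjoint pp) linearB/= (projection_idem pp) subrr.
  exact: linear0l.
by rewrite -[in LHS](subrK (p x) x) sqr_normD o conjC0 !addr0 addrC.
Qed.

Lemma projection_contraction H (p : 'B(H, H)) : projection p ->
  forall x, `|p x| <= `|x|.
Proof.
move=> pp x; rewrite -ler_sqr ?nnegrE// (projection_pythagoras pp x).
by rewrite lerDl exprn_ge0.
Qed.

Lemma projection_fixed H (p : 'B(H, H)) : projection p ->
  forall x, `|p x| = `|x| -> p x = x.
Proof.
move=> pp x; have := projection_pythagoras pp x => /[swap] ->.
rewrite -[X in X = _]addr0 => /addrI/esym/eqP.
by rewrite sqrf_eq0 normr_eq0 subr_eq0 => /eqP.
Qed.

(** With e = v^* v x, both <x, e> and |e|^2 equal |v x|^2, so |x|^2 - |v x|^2 = |x - e|^2 >= 0. *)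
Lemma partial_isometry_contraction H K (v : 'B(H, K)) : partial_isometry v ->
  forall x, `|v x| <= `|x|.
Proof.
move=> vv x; have vE z : v (adjoint v (v z)) = v z by rewrite -[in RHS]vv.
have [va|v0] := adjointP v; last by rewrite -vE v0 linear0 normr0.
set e := adjoint v (v x).
have xe : hdot x e = `|v x| ^+ 2 by rewrite -va hdotE.
have ee : `|e| ^+ 2 = `|v x| ^+ 2 by rewrite -hdotE -va vE hdotE.
have := sqr_normB x e.
rewrite xe ee geC0_conj ?exprn_ge0// opprD addrA addrK => d.
by rewrite -ler_sqr ?nnegrE// -subr_ge0 -d exprn_ge0.
Qed.

(** * The closed subspace on which a contraction is isometric *)

Section IsometrySet.
Variables (H K : hilbertType R) (c : 'B(H, K)).
Hypothesis c_le : forall x, `|c x| <= `|x|.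

Let E := [set x : H | `|c x| = `|x|].

Lemma isometry_set0 : E 0.
Proof. by rewrite /E/= linear0 !normr0. Qed.

Lemma isometry_setZ a x : E x -> E (a *: x).
Proof. by rewrite /E/= linearZ/= !normrZ => ->. Qed.

(** The parallelogram laws for [x, y] and for [c x, c y] have equal totals; since [c] cannot
    increase |x - y|, it cannot decrease |x + y|. *)
Lemma isometry_setD x y : E x -> E y -> E (x + y).
Proof.
rewrite /E/= => Ex Ey; apply/eqP; rewrite eq_le c_le/= -ler_sqr ?nnegrE//.
have := parallelogram (c x) (c y).
rewrite Ex Ey -parallelogram -linearD -linearB => par.
rewrite -(lerD2r (`|c (x - y)| ^+ 2)) par lerD2l.
by rewrite ler_sqr ?nnegrE.
Qed.

Lemma isometry_set_closed : closed E.
Proof.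
move=> x clx; apply/eqP; rewrite eq_le c_le/=; apply/ler_addgt0Pr => e e0.
have e20 : 0 < e / 2 by rewrite divr_gt0.
have [a [Ea]] := clx _ (nbhsx_ballx x _ e20).
rewrite -ball_normE/= => xa.
have ca : `|a| <= `|c x| + e / 2.
  rewrite -Ea -[X in c X](subrK x) addrC linearD (le_trans (ler_normD _ _))//.
  by rewrite lerD2l (le_trans (c_le _))// distrC ltW.
rewrite -[X in `|X|](subrK a) (le_trans (ler_normD _ _))// addrC.
by rewrite [X in _ <= _ + X]splitr addrA lerD// ltW.
Qed.

(** A projection onto [E] exists, so [get] returns one rather than its default value. *)
Lemma iso_projectionP : projection (iso_projection c) /\
  range (iso_projection c) = E.
Proof.
rewrite /iso_projection /projection_onto.
have [p [pE pid pa]] := projection_exists isometry_set0 isometry_setD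
  isometry_setZ isometry_set_closed.
apply: (getPex
  (ex_intro [set p : 'B(H, H) | projection p /\ range p = E] p _)).
split; first by apply: selfadjoint_idem_projection => // x; apply/pid/pE.
apply/seteqP; split => [_ [x _ <-]|x Ex]; first exact: pE.
by exists x => //; exact: pid.
Qed.

Lemma iso_projection_in x : `|c (iso_projection c x)| = `|iso_projection c x|.
Proof.
have [_ rE] := iso_projectionP.
suff : E (iso_projection c x) by [].
by rewrite -rE; exists x.
Qed.

Lemma iso_projection_id x : `|c x| = `|x| -> iso_projection c x = x.
Proof.
have [pp rE] := iso_projectionP.
move=> cx; have : E x by [].
by rewrite -rE => -[y _ <-]; exact: projection_idem.
Qed.

End IsometrySet.

End Operators.

(** * Comparison of the two triple products *)

Theorem theorem2p8 (R : realType) (H1 H2 H3 H4 : hilbertType R)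
  (w : 'B(H1, H2)) (v : 'B(H2, H3)) (u : 'B(H3, H4))
  (hw : partial_isometry w) (hv : partial_isometry v)
  (hu : partial_isometry u) :
  (u \cdot v) \cdot w = u \cdot (v \cdot w).
Proof.
have w_le := partial_isometry_contraction hw.
have v_le := partial_isometry_contraction hv.
have u_le := partial_isometry_contraction hu.
have uv_le x : `|opcomp u v x| <= `|x| by exact: le_trans (u_le _) (v_le _).
have vw_le x : `|opcomp v w x| <= `|x| by exact: le_trans (v_le _) (w_le _).
have uvw_le x : `|opcomp u (opcomp v w) x| <= `|x|.
  by exact: le_trans (u_le _) (vw_le _).
set p := iso_projection (opcomp u v).
set q := iso_projection (opcomp v w).
set r := iso_projection (opcomp u (opcomp v w)).
have [pp _] := iso_projectionP uv_le.
have [qp _] := iso_projectionP vw_le.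
have pw x : `|u (v (w x))| = `|x| -> p (w x) = w x.
  move=> Ex; apply: iso_projection_id => //; apply/eqP.
  by rewrite eq_le uv_le/= Ex w_le.
have qx x : `|u (v (w x))| = `|x| -> q x = x.
  move=> Ex; apply: iso_projection_id => //; apply/eqP.
  by rewrite eq_le vw_le/= -[X in X <= _]Ex u_le.
have lE : iso_projection (opcomp (u \cdot v) w) = r.
  rewrite /r /iso_projection; congr projection_onto.
  apply/seteqP; split => x /= Ex; last by rewrite pw.
  (* Equality holds throughout |x| = |u v p w x| <= |p w x| <= |w x| <= |x|. *)
  rewrite -[in LHS](_ : p (w x) = w x)//; apply: projection_fixed => //.
  apply/eqP; rewrite eq_le projection_contraction//= (le_trans (w_le x))//.
  by rewrite -Ex; exact: uv_le.
have rE : iso_projection (opcomp u (v \cdot w)) = r.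
  rewrite /r /iso_projection; congr projection_onto.
  apply/seteqP; split => x /= Ex; last by rewrite qx.
  (* Equality holds throughout |x| = |u v w q x| <= |q x| <= |x|. *)
  rewrite -[X in w X](_ : q x = x)//; apply: projection_fixed => //.
  apply/eqP; rewrite eq_le projection_contraction//= -[X in X <= _]Ex.
  exact: uvw_le.
apply: boundedopP => x.
rewrite -[LHS]/(u (v (p (w (iso_projection (opcomp (u \cdot v) w) x))))).
rewrite -[RHS]/(u (v (w (q (iso_projection (opcomp u (v \cdot w)) x))))).
(* [uvw] preserves the norm of [r x], so [p] fixes [w (r x)] and [q] fixes [r x]; both sides become
   [u (v (w (r x)))]. *)
have rx := iso_projection_in uvw_le x.
by rewrite lE rE pw// qx.
Qed.
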